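(* Let $H$ be a Hilbert space over $\mathbb{R}$ or $\mathbb{C}$, let $[a,b]$ be a compact real interval, and let $\Delta := \{(t,s)\in\mathbb{R}^2 : a\le t\le s\le b\}$. Let $f\in L([a,b];H)$ be such that there exist real numbers $M\ge 1\ge m\ge 0$ such that either $$\operatorname{Re}\langle Mf(s)-f(t),\, f(t)-mf(s)\rangle \ge 0\quad\text{for a.e. }(t,s)\in\Delta,$$ or, equivalently, $$\left\|f(t)-\frac{M+m}{2}f(s)\right\| \le \frac12 (M-m)\|f(s)\|\quad\text{for a.e. }(t,s)\in\Delta.$$ Then $$\left(\int_a^b\|f(t)\|\,dt\right)^2 \le \left\|\int_a^b f(t)\,dt\right\|^2 + \frac12\cdot\frac{(M-m)^2}{M+m}\int_a^b (s-a)\|f(s)\|^2\,ds. \qquad ( * )$$ Equality holds in $( * )$ if and only if $$\|f(t)\|\,\|f(s)\| - \operatorname{Re}\langle f(t),f(s)\rangle = \frac14\cdot\frac{(M-m)^2}{M+m}\|f(s)\|^2\quad\text{for a.e. }(t,s)\in\Delta.$$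
   Context: $L([a,b];H)$ denotes the space of Bochner integrable functions on $[a,b]$ (with Lebesgue measure) with values in the Hilbert space $H$. $\langle\cdot,\cdot\rangle$ is the inner product of $H$ and $\|\cdot\|$ its norm. ''For a.e. $(t,s)\in\Delta$'' refers to two-dimensional Lebesgue measure. The integral $\int_a^b (s-a)\|f(s)\|^2\,ds$ of a nonnegative measurable function is understood as an element of $[0,\infty]$. *)

(* Defs.v *)
From HB Require Import structures.
From mathcomp Require Import all_boot all_order all_algebra.
From mathcomp Require Import sesquilinear complex.
From mathcomp Require Import all_classical all_reals all_analysis.

Set Implicit Arguments.
Unset Strict Implicit.
Unset Printing Implicit Defensive.

Import Order.TTheory GRing.Theory Num.Theory.
Import numFieldNormedType.Exports.

Local Open Scope classical_set_scope.
Local Open Scope ring_scope.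

Variant scalars := RealScalars | ComplexScalars.

Definition scalar_field (R : realType) (k : scalars) : numFieldType :=
  match k with
  | RealScalars => R
  | ComplexScalars => R[i]
  end.

Definition scalar_of_real (R : realType) (k : scalars) :
    R -> scalar_field R k :=
  match k return R -> scalar_field R k with
  | RealScalars => fun x => x
  | ComplexScalars => fun x => x%:C%C
  end.

Definition scalar_Re (R : realType) (k : scalars) : scalar_field R k -> R :=
  match k return scalar_field R k -> R with
  | RealScalars => fun z => z
  | ComplexScalars => fun z => complex.Re z
  end.

Definition scalar_conj (R : realType) (k : scalars) :
    scalar_field R k -> scalar_field R k :=
  match k return scalar_field R k -> scalar_field R k with
  | RealScalars => fun z => z
  | ComplexScalars => fun z => (z^*)%C
  end.

(* The inner product is linear in its first argument and conjugate-linear in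
   its second one. *)
Record hilbertSpace (R : realType) (k : scalars) := HilbertSpace {
  hilbert_carrier :> completeNormedModType (scalar_field R k);
  inner : {dot hilbert_carrier for @scalar_conj R k};
  sqr_norm_inner : forall x : hilbert_carrier, `|x| ^+ 2 = inner x x
}.

Section real_norm.
Context (R : realType) (k : scalars) (V : normedModType (scalar_field R k)).

(* [`|x|] is an element of [scalar_field R k]; in the complex case it has a
   null imaginary part. *)
Definition rnorm (x : V) : R := scalar_Re `|x|.

Definition rscale (r : R) (x : V) : V := scalar_of_real k r *: x.

End real_norm.

Section bochner.
Context d (T : measurableType d) (R : realType) (k : scalars).
Context (V : completeNormedModType (scalar_field R k)).
Implicit Types (mu : {measure set T -> \bar R}) (D : set T) (f : T -> V).

Definition simple_on mu D (s : T -> V) : Prop :=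
  [/\ finite_set (s @` D),
      forall v, measurable (D `&` s @^-1` [set v]) &
      forall v, v != 0 -> (mu (D `&` s @^-1` [set v]) < +oo)%E].

Definition simple_integral mu D (s : T -> V) : V :=
  \sum_(v \in s @` D) rscale (fine (mu (D `&` s @^-1` [set v]))) v.

Definition strongly_measurable mu D f : Prop :=
  exists2 s_ : nat -> T -> V, (forall n, simple_on mu D (s_ n)) &
    {ae mu, forall x, D x -> s_ n x @[n --> \oo] --> f x}.

Definition bochner_approx mu D f (s_ : nat -> T -> V) : Prop :=
  (forall n, simple_on mu D (s_ n)) /\
  (\int[mu]_(x in D) (rnorm (f x - s_ n x))%:E @[n --> \oo] --> 0)%E.

(* Strong measurability is not redundant: on non-measurable nonnegative
   functions [\int] is only a lower integral. *)
Definition bochner_integrable mu D f : Prop :=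
  strongly_measurable mu D f /\ exists s_, bochner_approx mu D f s_.

(* The limit does not depend on the approximating sequence when [f] is Bochner
   integrable; [0] is a default value otherwise. *)
Definition bochner_integral mu D f : V :=
  xget 0 [set I | exists2 s_ : nat -> T -> V, bochner_approx mu D f s_ &
    simple_integral mu D (s_ n) @[n --> \oo] --> I].

End bochner.

Definition Delta (R : realType) (a b : R) : set (R * R) :=
  [set p | [/\ a <= p.1, p.1 <= p.2 & p.2 <= b]].

(* [P t s] for almost every (t, s) in Delta, w.r.t. two-dimensional Lebesgue
   measure *)
Definition ae_Delta (R : realType) (a b : R) (P : R -> R -> Prop) : Prop :=
  {ae (@lebesgue_measure R \x @lebesgue_measure R)%E,
    forall p : R * R, Delta a b p -> P p.1 p.2}.

(* Main.v *)
(* Write [K (t, s) = |f t| |f s| - Re <f t, f s>], which is nonnegative and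
   symmetric.  By Tonelli's theorem,
   [(int |f|)^2 - |int f|^2] is the integral of [K] over the square, i.e. twice
   its integral over Delta.  Expanding the norm condition and applying AM-GM to
   [|f t|^2 + ((M + m) / 2)^2 |f s|^2] bounds [K (t, s)] by
   [(M - m)^2 / (4 (M + m)) |f s|^2] on Delta, and integrating this bound in [t]
   produces the weight [s - a].  Since the integral of [K] is finite, the two
   integrals over Delta agree iff the pointwise bound is an equality a.e.
   As Lebesgue measure is only considered on Borel sets, [f] is first replaced
   by an a.e. equal pointwise limit [g] of simple functions. *)

Require Import Defs.
From mathcomp Require Import all_boot all_order all_algebra finmap.
From mathcomp Require Import sesquilinear complex.
From mathcomp Require Import all_classical all_reals all_analysis.
From mathcomp Require Import measurable_realfun.
From mathcomp Require Import ring lra.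

Import Order.TTheory GRing.Theory Num.Theory.
Import numFieldNormedType.Exports.

Local Open Scope classical_set_scope.
Local Open Scope ring_scope.

Set Implicit Arguments.
Unset Strict Implicit.
Unset Printing Implicit Defensive.

(** * Real-valued norm and inner product *)

Lemma scalar_ReD (R : realType) k (x y : scalar_field R k) :
  scalar_Re (x + y) = scalar_Re x + scalar_Re y.
Proof. by case: k x y => //= -[? ?] [? ?]. Qed.

Lemma scalar_ReZ (R : realType) k r (x : scalar_field R k) :
  scalar_Re (scalar_of_real k r * x) = r * scalar_Re x.
Proof. by case: k x => //= -[? ?]; rewrite /= mul0r subr0. Qed.

Lemma scalar_Re_conj (R : realType) k (x : scalar_field R k) :
  scalar_Re (scalar_conj x) = scalar_Re x.
Proof. by case: k x => //= -[? ?]. Qed.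

Lemma scalar_of_realK (R : realType) k (r : R) :
  scalar_Re (scalar_of_real k r) = r.
Proof. by case: k. Qed.

Lemma ge0_scalar_ReK (R : realType) k (x : scalar_field R k) :
  0 <= x -> scalar_of_real k (scalar_Re x) = x.
Proof.
case: k x => //= -[x y]; rewrite lecE /= => /andP[/eqP -> _]//.
Qed.

Lemma scalar_of_real_le (R : realType) k (r s : R) :
  (scalar_of_real k r <= scalar_of_real k s) = (r <= s).
Proof. by case: k => //=; rewrite lecR. Qed.

Lemma scalar_of_realD (R : realType) k (r s : R) :
  scalar_of_real k (r + s) = scalar_of_real k r + scalar_of_real k s.
Proof. by case: k => //=; rewrite rmorphD. Qed.

Lemma scalar_of_realM (R : realType) k (r s : R) :
  scalar_of_real k (r * s) = scalar_of_real k r * scalar_of_real k s.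
Proof. by case: k => //=; rewrite rmorphM. Qed.

Lemma scalar_of_real0 (R : realType) k : scalar_of_real k (0 : R) = 0.
Proof. by case: k. Qed.

Section rnorm_theory.
Context (R : realType) (k : scalars) (V : normedModType (scalar_field R k)).
Implicit Types x y : V.

Lemma rnormK x : scalar_of_real k (rnorm x) = `|x|.
Proof. exact: ge0_scalar_ReK. Qed.

Lemma rnorm_ge0 x : 0 <= rnorm x.
Proof. by rewrite -(scalar_of_real_le k) rnormK scalar_of_real0. Qed.

Lemma rnormD x y : rnorm (x + y) <= rnorm x + rnorm y.
Proof. by rewrite -(scalar_of_real_le k) scalar_of_realD !rnormK ler_normD. Qed.

Lemma rnormN x : rnorm (- x) = rnorm x.
Proof. by rewrite /rnorm normrN. Qed.

Lemma rnorm0 : rnorm (0 : V) = 0.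
Proof. by rewrite /rnorm normr0; case: k. Qed.

Lemma rnorm0_eq0 x : rnorm x = 0 -> x = 0.
Proof. by move=> x0; apply: normr0_eq0; rewrite -rnormK x0 scalar_of_real0. Qed.

Lemma rnormB x y : rnorm (x - y) = rnorm (y - x).
Proof. by rewrite -rnormN opprB. Qed.

Lemma scalar_of_real_lt (r s : R) :
  (scalar_of_real k r < scalar_of_real k s) = (r < s).
Proof. by case: k => //=; rewrite ltcR. Qed.

Lemma cvg_rnorm (u : nat -> V) x :
  u @ \oo --> x -> rnorm (u n - x) @[n --> \oo] --> (0 : R).
Proof.
move=> ux; apply/cvgr0Pnorm_lt => e e0.
have e0' : 0 < scalar_of_real k e.
  by rewrite -(scalar_of_real0 R) scalar_of_real_lt.
move/cvgrPdist_lt : ux => /(_ _ e0').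
apply: filterS => n; rewrite -rnormK scalar_of_real_lt rnormB.
by rewrite ger0_norm ?rnorm_ge0.
Qed.

End rnorm_theory.

Lemma rnorm_cauchy_cvg (R : realType) k
    (V : completeNormedModType (scalar_field R k)) (u : nat -> V) (e : nat -> R) :
  (forall n m, rnorm (u n - u m) <= e n + e m) -> e @ \oo --> (0 : R) ->
  cvgn u.
Proof.
move=> ue e0; apply/cauchy_cvgP/cauchy_ballP => eps eps0 /=.
(* The radius [eps] is a scalar, possibly complex; being positive, it is the image of a real number,
   so the comparison can take place in [R]. *)
have Eeps := ge0_scalar_ReK (ltW eps0).
have reps0 : 0 < scalar_Re eps.
  by rewrite -(scalar_of_real_lt k) Eeps scalar_of_real0.
have /cvgr0Pnorm_lt /(_ _ (divr_gt0 reps0 (@ltr0Sn _ 1))) := e0.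
move=> small.
(* Terms of the sequence with error below half the radius: by the split bound [e n + e m], any two
   of them are within [eps] of each other. *)
pose A := u @` [set n | `|e n| < scalar_Re eps / 2].
have FA : (u @ \oo) A by apply: filterS small => n en; exists n.
exists (A, A) => //= -[_ _] /= [[n en <-] [m em <-]].
rewrite -ball_normE /= -rnormK -Eeps scalar_of_real_lt.
apply: le_lt_trans (ue n m) _; move: en em; rewrite /= !ltr_norml; lra.
Qed.

Section real_inner.
Context (R : realType) (k : scalars) (H : hilbertSpace R k).
Implicit Types x y z : H.

(** The real part turns [H] into a real inner product space, so that later estimates treat both
    scalar cases at once. *)
Definition rinner x y : R := scalar_Re (inner H x y).

Lemma rinnerDl x y z : rinner (x + y) z = rinner x z + rinner y z.
Proof. by rewrite /rinner linearDl scalar_ReD. Qed.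

Lemma rinnerZl r x y : rinner (rscale r x) y = r * rinner x y.
Proof. by rewrite /rinner /rscale linearZl_LR scalar_ReZ. Qed.

Lemma rinnerC x y : rinner x y = rinner y x.
Proof.
by rewrite /rinner hermitian_subproof expr0 mul1r scalar_Re_conj.
Qed.

Lemma rinnerxx x : rinner x x = rnorm x ^+ 2.
Proof.
rewrite /rinner -sqr_norm_inner -rnormK expr2 -scalar_of_realM.
by rewrite scalar_of_realK expr2.
Qed.

Lemma rinnerNl x y : rinner (- x) y = - rinner x y.
Proof.
have: rinner (x - x) y = 0.
  by rewrite subrr /rinner linear0l; case: k.
by rewrite rinnerDl; lra.
Qed.

Lemma rinnerBl x y z : rinner (x - y) z = rinner x z - rinner y z.
Proof. by rewrite rinnerDl rinnerNl. Qed.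

Lemma rinnerBr x y z : rinner x (y - z) = rinner x y - rinner x z.
Proof. by rewrite rinnerC rinnerBl !(rinnerC _ x). Qed.

Lemma rinnerZr r x y : rinner x (rscale r y) = r * rinner x y.
Proof. by rewrite rinnerC rinnerZl rinnerC. Qed.

Lemma rinner0l y : rinner 0 y = 0.
Proof. by rewrite -(subrr y) rinnerBl subrr. Qed.

Lemma rinner_suml I (r : seq I) (F : I -> H) y :
  rinner (\sum_(i <- r) F i) y = \sum_(i <- r) rinner (F i) y.
Proof.
apply: (big_morph (rinner^~ y)); last exact: rinner0l.
by move=> ? ?; exact: rinnerDl.
Qed.

(** Cauchy-Schwarz: the squared norm of |y| x - |x| y equals 2 |x| |y| (|x| |y| - <x, y>), and it is
    nonnegative. *)
Lemma le_rinner x y : rinner x y <= rnorm x * rnorm y.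
Proof.
have [x0|x0] := eqVneq (rnorm x) 0.
  by rewrite x0 mul0r (rnorm0_eq0 x0) rinner0l.
have [y0|y0] := eqVneq (rnorm y) 0.
  by rewrite y0 mulr0 (rnorm0_eq0 y0) rinnerC rinner0l.
have xp : 0 < rnorm x by rewrite lt_def x0 rnorm_ge0.
have yp : 0 < rnorm y by rewrite lt_def y0 rnorm_ge0.
have : 0 <= rinner (rscale (rnorm y) x - rscale (rnorm x) y)
                   (rscale (rnorm y) x - rscale (rnorm x) y).
  by rewrite rinnerxx sqr_ge0.
rewrite rinnerBl !rinnerBr !rinnerZl !rinnerZr !rinnerxx (rinnerC y x).
move=> h; rewrite -subr_ge0 -(pmulr_lge0 _ (mulr_gt0 xp yp)).
by nra.
Qed.

Lemma normr_rinner_le x y : `|rinner x y| <= rnorm x * rnorm y.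
Proof.
by rewrite ler_norml lerNl -rinnerNl le_rinner andbT -(rnormN x) le_rinner.
Qed.

(** With u = x - ((M + m) / 2) y and r = (M - m) / 2, the two vectors are r y - u and r y + u. The
    cross terms cancel because [rinner] is symmetric. *)
Lemma rinner_sandwichE (M m : R) x y :
  rinner (rscale M y - x) (x - rscale m y) =
  ((M - m) / 2 * rnorm y) ^+ 2 - rnorm (x - rscale ((M + m) / 2) y) ^+ 2.
Proof.
rewrite -(rinnerxx (x - _)) !rinnerBl !rinnerBr !rinnerZl !rinnerZr.
by rewrite (rinnerC y x) !rinnerxx; field.
Qed.

Lemma rinner_sandwich_ge0 (M m : R) x y : m <= M ->
  0 <= rinner (rscale M y - x) (x - rscale m y) <->
  rnorm (x - rscale ((M + m) / 2) y) <= 1 / 2 * (M - m) * rnorm y.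
Proof.
move=> mM; rewrite rinner_sandwichE subr_ge0 (_ : 1 / 2 * (M - m) = (M - m) / 2).
  by rewrite ler_sqr// nnegrE ?rnorm_ge0// mulr_ge0 ?rnorm_ge0//; lra.
by field.
Qed.

Lemma rnormM_sub_rinner_le (M m : R) x y : 0 < M + m ->
  0 <= rinner (rscale M y - x) (x - rscale m y) ->
  rnorm x * rnorm y - rinner x y <=
    1 / 4 * ((M - m) ^+ 2 / (M + m)) * rnorm y ^+ 2.
Proof.
move=> Mm; rewrite !rinnerBl !rinnerBr !rinnerZl !rinnerZr.
rewrite (rinnerC y x) !rinnerxx => h.
rewrite -(ler_pM2l Mm) [leRHS](_ : _ = 1 / 4 * (M - m) ^+ 2 * rnorm y ^+ 2).
  (* The square bounds (M + m) |x| |y| above by |x|^2 + ((M + m)^2 / 4) |y|^2, while [h] bounds (M +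
     m) <x, y> below by |x|^2 + M m |y|^2. Subtracting leaves (M + m)^2 / 4 - M m = (M - m)^2 /
     4. *)
  have := sqr_ge0 (rnorm x - (M + m) / 2 * rnorm y); nra.
by field; rewrite gt_eqF.
Qed.

End real_inner.

(** * Null sets and lower integrals *)

Section null_sets.
Import HBNNSimple.
Context d (T : measurableType d) (R : realType) (mu : {measure set T -> \bar R}).
Local Open Scope ereal_scope.

(* [f] need not be measurable, in which case [\int] is a lower integral. *)
Lemma ge0_integral_setD_null (D N : set T) (f : T -> \bar R) :
  measurable D -> measurable N -> mu N = 0 -> (forall x, D x -> 0 <= f x) ->
  \int[mu]_(x in D) f x = \int[mu]_(x in D `\` N) f x.
Proof.
move=> mD mN N0 f0.
have f0' x : (D `\` N) x -> 0 <= f x by move=> [/f0].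
apply/eqP; rewrite eq_le; apply/andP; split; last first.
  rewrite !ge0_integralE//; apply: ge_ereal_sup => _ [h hf <-].
  apply: ereal_sup_ubound; exists h => // x; apply: le_trans (hf x) _.
  rewrite !patchE; case: ifPn => [|xDN]; last first.
    by case: ifPn => //; rewrite inE => /f0.
  by rewrite inE => -[xD _]; rewrite mem_set.
rewrite !ge0_integralE//; apply: ge_ereal_sup => _ [h hf <-].
have mNC : measurable (~` N) by exact: measurableC.
(* A simple function below [f] on [D] may be nonzero on [N]. Multiplying it by the indicator of the
   complement of [N] makes it a competitor for the supremum over [D] minus [N], with the same
   integral since [N] is null. *)
apply: ereal_sup_ubound; exists (mul_nnsfun h (indic_nnsfun R mNC)).
  move=> x;
  rewrite [mul_nnsfun _ _ x](_ : _ = h x * \1_(~` N) x)%R// indicE patchE in_setC.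
  have := hf x; rewrite patchE; case: ifPn => xD.
    case: ifPn => [|] xDN.
      rewrite inE in xDN; move: xDN => [_ xN]; rewrite memNset//= mulr1//.
    rewrite inE in xD; rewrite notin_setE in xDN.
    by rewrite mem_set ?mulr0//; apply: contrapT => xN; apply: xDN; split.
  case: ifPn => [|xDN]; first by rewrite inE => -[] /mem_set; rewrite (negbTE xD).
  move=> hx; have -> : h x = 0%R; last by rewrite mul0r.
  by apply/eqP; rewrite eq_le -lee_fin hx /=; exact: fun_ge0.
rewrite -!integralT_nnsfun.
have h0 (g : {nnsfun T >-> R}) x : 0 <= (g x)%:E by rewrite lee_fin.
have mh (g : {nnsfun T >-> R}) : measurable_fun setT (fun x => (g x)%:E).
  exact/measurable_EFinP.
rewrite (ge0_negligible_integral mN)//.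
rewrite [RHS](ge0_negligible_integral mN)//.
apply: eq_integral => x; rewrite inE => -[_ xN] /=.
by rewrite -[X in (_ * X)%R]/(\1_(~` N) x) indicE mem_set// mulr1.
Qed.

End null_sets.

(** * Simple functions *)

Section simple_functions.
Context d (T : measurableType d) (R : realType) (k : scalars).
Context (V : completeNormedModType (scalar_field R k)).
Variable mu : {measure set T -> \bar R}.
Implicit Types (D E : set T) (s : T -> V).

(** Only nonzero values must have level sets of finite measure, so extension by 0 stays simple
    however large the complement of [E] is. *)
Lemma simple_on_patch D E s : measurable E -> E `<=` D ->
  simple_on mu D s -> simple_on mu setT (fun x => if x \in E then s x else 0).
Proof.
move=> mE ED ss; have [fs ms ls] := ss.
have mEs v : measurable (E `&` s @^-1` [set v]).
  by rewrite -(setIidl ED) -setIA; apply: measurableI.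
split.
- apply: (@sub_finite_set _ _ (s @` D `|` [set 0])).
    move=> _ [x _ <-]; case: ifPn => [|_]; last by right.
    by rewrite inE => /ED Dx; left; exists x.
  by rewrite finite_setU; split=> //; exact: finite_set1.
- move=> v; rewrite setTI.
  rewrite (_ : _ @^-1` _ =
    (E `&` s @^-1` [set v]) `|` (~` E `&` [set x | 0 = v])).
    apply: measurableU => //; apply: measurableI; first exact: measurableC.
    have [<-|v0] := pselect (0 = v).
      by rewrite (_ : [set _ | _] = setT)//; apply/seteqP; split.
    by rewrite (_ : [set _ | _] = set0)//; apply/seteqP; split.
  apply/seteqP; split => x; rewrite /=; case: ifPn => [|] xE.
  + by rewrite inE in xE; left.
  + by rewrite notin_setE in xE; right.
  + by rewrite inE in xE => -[[]|[]].
  + by rewrite notin_setE in xE => -[[]|[]].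
- move=> v v0; apply: le_lt_trans (ls v v0).
  rewrite setTI; apply: le_measure; rewrite ?inE//.
    rewrite (_ : _ @^-1` _ = E `&` s @^-1` [set v])//.
    apply/seteqP; split => x; rewrite /=; case: ifPn => [|] xE //.
    - by rewrite inE in xE.
    - by move=> v0'; rewrite -v0' eqxx in v0.
    - by move=> [].
    - by rewrite notin_setE in xE => -[].
  move=> x; rewrite /=; case: ifPn => [|_ v0'].
    by rewrite inE => /ED.
  by rewrite -v0' eqxx in v0.
Qed.

(** An arbitrary [phi] is allowed because preimages are finite unions of rectangles whose sides are
    level sets of [s] and [s']. *)
Lemma measurable_simple_on2 s s' (phi : V -> V -> R) :
  simple_on mu setT s -> simple_on mu setT s' ->
  measurable_fun setT (fun p : T * T => phi (s p.1) (s' p.2)).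
Proof.
move=> [fs ms _] [fs' ms' _] _ B mB; rewrite setTI.
rewrite (_ : _ @^-1` _ = \bigcup_(v in
     [set v | range s v.1 /\ range s' v.2 /\ B (phi v.1 v.2)])
   ((s @^-1` [set v.1]) `*` (s' @^-1` [set v.2]))).
  apply: fin_bigcup_measurable => [|v _].
    apply: (@sub_finite_set _ _ (range s `*` range s')); last exact: finite_setX.
    by move=> v [? []].
  by apply: measurableX; rewrite -[X in measurable X]setTI.
apply/seteqP; split=> [p Bp|p [v [_ [_ Bv]] [/= pv1 pv2]]] /=.
  by exists (s p.1, s' p.2) => //=; split; [exists p.1|split=> //; exists p.2].
by rewrite pv1 pv2.
Qed.

Lemma simple_onE D s (phi : V -> R) x : simple_on mu D s -> D x ->
  phi (s x) = \sum_(v <- fset_set (s @` D)) phi v * \1_(D `&` s @^-1` [set v]) x.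
Proof.
move=> [fs _ _] Dx; rewrite (bigD1_seq (s x)) ?fset_uniq//=; last first.
  by rewrite in_fset_set// inE; exists x.
rewrite indicE mem_set// mulr1 big1 ?addr0// => v vsx.
rewrite indicE memNset ?mulr0// => -[_ /= sxv].
by rewrite sxv eqxx in vsx.
Qed.

Section simple_integral.
Variables (D : set T) (s : T -> V) (phi : V -> R).
Hypotheses (mD : measurable D) (ss : simple_on mu D s) (phi0 : phi 0 = 0).

Let indic_integrable A : measurable A -> (mu A < +oo)%E ->
  mu.-integrable D (EFin \o \1_A).
Proof.
move=> mA Aoo; apply/integrableP; split.
  by apply/measurable_EFinP; exact: measurable_indic.
rewrite (eq_integral (EFin \o \1_A)) => [|x _]; last by rewrite gee0_abs// lee_fin.
rewrite integral_indic//; apply: le_lt_trans Aoo.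
by rewrite le_measure ?inE//; exact: measurableI.
Qed.

Let term_integrable v : mu.-integrable D
  (EFin \o (fun x => phi v * \1_(D `&` s @^-1` [set v]) x)).
Proof.
(* The level set of 0 may have infinite measure; its term is harmless because [phi 0 = 0]. *)
have [_ ms ls] := ss; have [->|v0] := eqVneq v 0.
  rewrite [X in integrable _ _ X](_ : _ = cst 0%E); first exact: integrable0.
  by apply/funext => x /=; rewrite phi0 mul0r.
apply: (@integrableZl _ _ _ mu D mD (phi v)
  (EFin \o \1_(D `&` s @^-1` [set v]))).
by apply: indic_integrable => //; exact: ls.
Qed.

Let simple_on_EFinE x : D x -> (phi (s x))%:E =
  (\sum_(v <- fset_set (s @` D)) (phi v * \1_(D `&` s @^-1` [set v]) x)%:E)%E.
Proof. by move=> Dx; rewrite (simple_onE phi ss Dx) sumEFin. Qed.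

Lemma simple_on_integrable : mu.-integrable D (fun x => (phi (s x))%:E).
Proof.
apply: (@eq_integrable _ _ _ mu D mD (fun x =>
  (\sum_(v <- fset_set (s @` D)) (phi v * \1_(D `&` s @^-1` [set v]) x)%:E)%E)).
  by move=> x; rewrite inE => Dx; rewrite simple_on_EFinE.
by apply: integrable_sum => // v _; exact: term_integrable.
Qed.

Lemma simple_on_integral : (\int[mu]_(x in D) (phi (s x))%:E =
  (\sum_(v <- fset_set (s @` D))
     fine (mu (D `&` s @^-1` [set v])) * phi v)%:E)%E.
Proof.
transitivity (\int[mu]_(x in D) \sum_(v <- fset_set (s @` D))
    (phi v * \1_(D `&` s @^-1` [set v]) x)%:E)%E.
  by apply: eq_integral => x; rewrite inE => Dx; rewrite simple_on_EFinE.
rewrite integral_sum//= -sumEFin; apply: eq_bigr => v _.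
have [_ ms ls] := ss; have [->|v0] := eqVneq v 0.
  rewrite phi0 mulr0; under eq_integral do rewrite mul0r.
  exact: integral0.
under eq_integral do rewrite EFinM.
have lv := ls v v0; have iv := indic_integrable (ms v) lv.
rewrite integralZl//.
rewrite integral_indic// setIAC setIid EFinM fineK ?ge0_fin_numE//.
by rewrite muleC.
Qed.

End simple_integral.

End simple_functions.

(** * Pointwise limits of simple functions *)

Lemma cvg_dist_le (R : realType) (a e : nat -> R) (l : R) :
  (forall n, `|a n - l| <= e n) -> e @ \oo --> (0 : R) -> a @ \oo --> l.
Proof.
move=> ae /cvgr0Pnorm_lt e0; apply/cvgrPdist_lt => eps eps0.
apply: filterS (e0 _ eps0) => n; apply: le_lt_trans; rewrite distrC.
by apply: le_trans (ae n) _; exact: ler_norm.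
Qed.

Section simple_limit.
Context d (T : measurableType d) (R : realType) (k : scalars).
Context (V : completeNormedModType (scalar_field R k)).
Variable mu : {measure set T -> \bar R}.
Implicit Types (D E : set T) (f g s : T -> V).

(** Strong measurability with convergence at every point rather than almost everywhere: norms and
    inner products of [g] are then measurable without completing the measure. *)
Definition simple_limit g := exists2 s_ : nat -> T -> V,
  (forall n, simple_on mu setT (s_ n)) & forall x, s_ n x @[n --> \oo] --> g x.

Lemma simple_on_cst0 D : measurable D -> simple_on mu D (fun=> 0 : V).
Proof.
move=> mD; split=> [|v|v v0].
- apply: (@sub_finite_set _ _ [set 0]); last exact: finite_set1.
  by move=> _ [x _ <-].
- have [->|v0] := eqVneq v 0.
    by rewrite (_ : _ @^-1` _ = setT) ?setIT//; apply/seteqP; split.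
  rewrite (_ : _ @^-1` _ = set0) ?setI0//.
  by apply/seteqP; split=> // x /= v0'; rewrite v0' eqxx in v0.
- rewrite (_ : _ @^-1` _ = set0) ?setI0 ?measure0//.
  by apply/seteqP; split=> // x /= v0'; rewrite v0' eqxx in v0.
Qed.

Lemma strongly_measurable_simple_limit D f : measurable D ->
  strongly_measurable mu D f -> exists g N, [/\ simple_limit g,
    measurable N, mu N = 0%E, (forall x, ~ D x -> g x = 0) &
    forall x, (D `\` N) x -> g x = f x].
Proof.
move=> mD [s_ ss [N [mN N0 sN]]].
(* Truncating both [f] and its approximants to [D] minus [N] makes the convergence hold
   everywhere. *)
exists (fun x => if x \in D `\` N then f x else 0), N; split=> //.
- exists (fun n x => if x \in D `\` N then s_ n x else 0) => [n|x].
    by apply: simple_on_patch (ss n); [exact: measurableD|move=> x []].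
  case: ifPn => [|_]; last exact: cvg_cst.
  rewrite inE => -[Dx Nx]; apply: contrapT => h; apply: Nx; apply: sN => /= h'.
  exact/h/h'.
- by move=> x Dx; case: ifPn => //; rewrite inE => -[].
- by move=> x DNx; rewrite mem_set.
Qed.

(** Measurability passes to pointwise limits; for the simple approximants it is
    [measurable_simple_on2] pulled back along the diagonal. *)
Lemma measurable_simple_limit (phi : V -> V -> R) g s :
  simple_limit g -> simple_on mu setT s ->
  (forall (u : nat -> V) x y, u @ \oo --> x ->
    phi (u n) y @[n --> \oo] --> phi x y) ->
  measurable_fun setT (fun x => phi (g x) (s x)).
Proof.
move=> [s_ ss sg] s0 cphi.
apply: (@measurable_fun_cvg _ _ _ setT (fun n x => phi (s_ n x) (s x))) => //.
  move=> n; apply: (@measurableT_comp _ _ _ _ _ _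
    (fun p : T * T => phi (s_ n p.1) (s p.2)) setT (fun x => (x, x))).
    exact: measurable_simple_on2 (ss n) s0.
  exact: measurable_fun_pair.
by move=> x _; apply: cphi; exact: sg.
Qed.

Lemma rnormB_cvg (u : nat -> V) x y : u @ \oo --> x ->
  rnorm (u n - y) @[n --> \oo] --> rnorm (x - y).
Proof.
move=> /cvg_rnorm; apply: cvg_dist_le => n; rewrite ler_norml.
have := rnormD (u n - x) (x - y); have := rnormD (x - u n) (u n - y).
by rewrite !subrKA (rnormB x (u n)); lra.
Qed.

Lemma measurable_rnormB g s : simple_limit g -> simple_on mu setT s ->
  measurable_fun setT (fun x => rnorm (g x - s x)).
Proof.
move=> gl ss.
apply: (measurable_simple_limit (phi := fun x y => rnorm (x - y)) gl ss).
by move=> u x y; exact: rnormB_cvg.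
Qed.

Lemma measurable_rnorm g : simple_limit g ->
  measurable_fun setT (fun x => rnorm (g x)).
Proof.
move=> gl; have := measurable_rnormB gl (simple_on_cst0 measurableT).
by under [X in measurable_fun _ X]eq_fun do rewrite subr0.
Qed.

End simple_limit.

Section simple_limit_hilbert.
Context d (T : measurableType d) (R : realType) (k : scalars).
Context (H : hilbertSpace R k).
Variable mu : {measure set T -> \bar R}.
Implicit Types (g : T -> H).

Lemma rinner_cvg (u v : nat -> H) x y : u @ \oo --> x -> v @ \oo --> y ->
  rinner (u n) (v n) @[n --> \oo] --> rinner x y.
Proof.
move=> /cvg_rnorm ux /cvg_rnorm vy.
apply: (@cvg_dist_le _ _ (fun n => rnorm (u n - x) * rnorm (v n - y) +
  rnorm (u n - x) * rnorm y + rnorm x * rnorm (v n - y))) => [n|].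
  have -> : rinner (u n) (v n) - rinner x y = rinner (u n - x) (v n - y) +
      rinner (u n - x) y + rinner x (v n - y).
    by rewrite !rinnerBl !rinnerBr; ring.
  do 2 (apply: le_trans (ler_normD _ _) _; apply: lerD; rewrite ?normr_rinner_le//).
rewrite [X in _ --> X](_ : _ = 0 * 0 + 0 * rnorm y + rnorm x * 0); last by ring.
apply: cvgD; first (apply: cvgD; first exact: cvgM).
- by apply: cvgM => //; exact: cvg_cst.
- by apply: cvgM => //; exact: cvg_cst.
Qed.

Lemma measurable_rinner g v : simple_limit mu g ->
  measurable_fun setT (fun x => rinner (g x) v).
Proof.
move=> gl; apply: (measurable_simple_limit (phi := fun x _ => rinner x v) gl
  (simple_on_cst0 _ _ measurableT)).
by move=> u x y ux; apply: rinner_cvg ux _; exact: cvg_cst.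
Qed.

Lemma measurable_rinner2 g : simple_limit mu g ->
  measurable_fun setT (fun p : T * T => rinner (g p.1) (g p.2)).
Proof.
move=> [s_ ss sg].
apply: (@measurable_fun_cvg _ _ _ setT
  (fun n (p : T * T) => rinner (s_ n p.1) (s_ n p.2))) => //.
  by move=> n; exact: (measurable_simple_on2 (@rinner _ _ H) (ss n) (ss n)).
by move=> p _; apply: rinner_cvg; exact: sg.
Qed.

End simple_limit_hilbert.

(** * Approximation in the mean by simple functions *)

Section bochner_approx.
Context d (T : measurableType d) (R : realType) (k : scalars).
Context (V : completeNormedModType (scalar_field R k)).
Variables (mu : {measure set T -> \bar R}) (D : set T).
Hypothesis mD : measurable D.
Implicit Types (f g s : T -> V).

(** Since [f] is not assumed measurable, these are lower integrals; both are reduced to [D] minus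
    [N], where [f] and [g] coincide. *)
Lemma bochner_approx_ae_eq N f g (s_ : nat -> T -> V) :
  measurable N -> mu N = 0%E ->
  (forall x, (D `\` N) x -> g x = f x) ->
  bochner_approx mu D f s_ <-> bochner_approx mu D g s_.
Proof.
move=> mN N0 gf.
rewrite /bochner_approx.
suff -> : (fun n => \int[mu]_(x in D) (rnorm (f x - s_ n x))%:E)%E =
    (fun n => \int[mu]_(x in D) (rnorm (g x - s_ n x))%:E)%E by [].
apply/funext => n.
rewrite (ge0_integral_setD_null mD mN N0); last first.
  by move=> x _; rewrite lee_fin rnorm_ge0.
rewrite [RHS](ge0_integral_setD_null mD mN N0); last first.
  by move=> x _; rewrite lee_fin rnorm_ge0.
by apply: eq_integral => x; rewrite inE => /gf ->.
Qed.

Lemma measurable_rnormB_on g s : simple_limit mu g -> simple_on mu D s ->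
  measurable_fun D (fun x => rnorm (g x - s x)).
Proof.
move=> gl ss.
have ss' := simple_on_patch mD (@subset_refl _ D) ss.
apply: eq_measurable_fun (measurable_funTS (measurable_rnormB gl ss')).
by move=> x xD /=; rewrite xD.
Qed.

(** Convergence to 0 makes the integral of |g - s_n| finite for some n, and |g| <= |g - s_n| +
    |s_n|. *)
Lemma bochner_approx_integrable_rnorm g (s_ : nat -> T -> V) : simple_limit mu g ->
  bochner_approx mu D g s_ -> mu.-integrable D (fun x => (rnorm (g x))%:E).
Proof.
move=> gl [ss s0].
have [n sn] : exists n, (\int[mu]_(x in D) (rnorm (g x - s_ n x))%:E < +oo)%E.
  have /fine_cvgP[/filter_ex[n sn] _] := s0; exists n.
  by rewrite -ge0_fin_numE// integral_ge0// => x _; rewrite lee_fin rnorm_ge0.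

have is_ := simple_on_integrable mD (ss n) (rnorm0 _).
have igs : mu.-integrable D (fun x => (rnorm (g x - s_ n x))%:E).
  apply/integrableP; split; first by apply/measurable_EFinP; exact: measurable_rnormB_on.
  rewrite (eq_integral (fun x => (rnorm (g x - s_ n x))%:E)) => [|x _]; last first.
    by rewrite gee0_abs// lee_fin rnorm_ge0.
  exact: sn.
apply: le_integrable (integrableD mD igs is_) => //.
  by apply/measurable_EFinP; apply: measurable_funTS; exact: measurable_rnorm gl.
move=> x Dx /=; rewrite lee_fin !ger0_norm ?addr_ge0 ?rnorm_ge0//.
by apply: le_trans _ (rnormD _ _); rewrite subrK.
Qed.

Lemma bochner_approx_integrable_rnormB g (s_ : nat -> T -> V) n : simple_limit mu g ->
  bochner_approx mu D g s_ ->
  mu.-integrable D (fun x => (rnorm (g x - s_ n x))%:E).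
Proof.
move=> gl gs; have ig := bochner_approx_integrable_rnorm gl gs.
have is_ := simple_on_integrable mD (gs.1 n) (rnorm0 _).
apply: le_integrable (integrableD mD ig is_) => //.
  by apply/measurable_EFinP; exact: measurable_rnormB_on gl (gs.1 n).
move=> x Dx /=; rewrite lee_fin !ger0_norm ?addr_ge0 ?rnorm_ge0//.
by apply: le_trans (rnormD _ _) _; rewrite rnormN.
Qed.

Lemma bochner_approx_Rintegral_cvg0 g (s_ : nat -> T -> V) :
  bochner_approx mu D g s_ ->
  \int[mu]_(x in D) rnorm (g x - s_ n x) @[n --> \oo] --> (0 : R).
Proof.
move=> [ss]; exact: (@fine_cvg _ _ _ _ _ (0 : R)).
Qed.

End bochner_approx.

(** * The Bochner integral in a Hilbert space *)

Section bochner_integral_hilbert.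
Context d (T : measurableType d) (R : realType) (k : scalars).
Context (H : hilbertSpace R k).
Variables (mu : {measure set T -> \bar R}) (D : set T).
Hypothesis mD : measurable D.
Implicit Types (f g s : T -> H) (v : H).

Lemma rinner_simple_integral s v : simple_on mu D s ->
  rinner (simple_integral mu D s) v = \int[mu]_(x in D) rinner (s x) v.
Proof.
move=> ss; rewrite /Rintegral.
rewrite (simple_on_integral mD ss (phi := fun x : H => rinner x v) (rinner0l v)) /=.
rewrite /simple_integral fsbig_finite; last by case: ss.
by rewrite rinner_suml; apply: eq_bigr => w _; rewrite rinnerZl.
Qed.

Lemma integrable_rinner g v : simple_limit mu g ->
  mu.-integrable D (fun x => (rnorm (g x))%:E) ->
  mu.-integrable D (fun x => (rinner (g x) v)%:E).
Proof.
move=> gl ig; apply: le_integrable (integrableZl mD (rnorm v) ig) => //.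
  by apply/measurable_EFinP; apply: measurable_funTS; exact: measurable_rinner gl.
move=> x Dx /=; rewrite lee_fin normrM !(ger0_norm (rnorm_ge0 _)) mulrC.
exact: normr_rinner_le.
Qed.

Section limit.
Variables (g : T -> H) (s_ : nat -> T -> H).
Hypotheses (gl : simple_limit mu g) (gs : bochner_approx mu D g s_).

Let e n := \int[mu]_(x in D) rnorm (g x - s_ n x).

(** A weak error estimate: pairing with [v] turns the simple integral into a Lebesgue integral, and
    Cauchy-Schwarz is applied under the integral sign. *)
Lemma simple_integral_rinner_dist n v :
  `|rinner (simple_integral mu D (s_ n)) v - \int[mu]_(x in D) rinner (g x) v| <=
  rnorm v * e n.
Proof.
have ig := integrable_rinner v gl (bochner_approx_integrable_rnorm mD gl gs).
have is_ := simple_on_integrable mD (gs.1 n) (phi := fun x : H => rinner x v) (rinner0l v).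
have igs := bochner_approx_integrable_rnormB mD n gl gs.
rewrite (rinner_simple_integral _ (gs.1 n)) -RintegralB//.
apply: le_trans (le_normr_Rintegral _ _) _ => //.
  exact: (integrableB mD is_ ig).
rewrite -RintegralZl//; apply: le_Rintegral => //.
- exact: (integrable_abse (integrableB mD is_ ig)).
- exact: (integrableZl mD _ igs).
- by move=> x Dx; rewrite -rinnerBl rnormB mulrC normr_rinner_le.
Qed.

(** The difference v of two simple integrals is tested against itself: the weak estimate gives |v|^2
    <= |v| (e n + e m), and dividing by |v| yields the Cauchy property in norm. *)
Lemma simple_integral_cvg : cvgn (fun n => simple_integral mu D (s_ n)).
Proof.
apply: (@rnorm_cauchy_cvg _ _ _ _ e); last exact: bochner_approx_Rintegral_cvg0 gs.
move=> n m; set v := _ - _.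
have e0 i : 0 <= e i by apply: Rintegral_ge0 => x _; exact: rnorm_ge0.
have [->|v0] := eqVneq (rnorm v) 0; first exact: addr_ge0.
have vp : 0 < rnorm v by rewrite lt_def v0 rnorm_ge0.
rewrite -(ler_pM2l vp) -expr2 -rinnerxx {1}/v rinnerBl.
have := simple_integral_rinner_dist n v; have := simple_integral_rinner_dist m v.
rewrite !ler_norml; lra.
Qed.

Lemma simple_integral_rinner_lim (I : H) v :
  simple_integral mu D (s_ n) @[n --> \oo] --> I ->
  rinner I v = \int[mu]_(x in D) rinner (g x) v.
Proof.
move=> sI.
have c1 : rinner (simple_integral mu D (s_ n)) v @[n --> \oo] --> rinner I v.
  by apply: rinner_cvg sI _; exact: cvg_cst.
apply: (cvg_unique _ c1) => //.
apply: (@cvg_dist_le _ _ (fun n => rnorm v * e n)) => [n|].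
  exact: simple_integral_rinner_dist.
rewrite -(mulr0 (rnorm v)); apply: cvgM; first exact: cvg_cst.
exact: bochner_approx_Rintegral_cvg0 gs.
Qed.

End limit.

(* Tested against a vector, the Bochner integral becomes a Lebesgue integral;
   this is all that is needed to expand its squared norm. *)
Lemma bochner_integral_version f : bochner_integrable mu D f ->
  exists g N, [/\ simple_limit mu g, measurable N, mu N = 0%E,
    (forall x, ~ D x -> g x = 0) & forall x, (D `\` N) x -> g x = f x] /\
  (mu.-integrable setT (fun x => (rnorm (g x))%:E) /\
   forall v, rinner (bochner_integral mu D f) v = \int[mu]_x rinner (g x) v).
Proof.
move=> [sf [s_ fs]].
have [g [N [gl mN N0 g0 gf]]] := strongly_measurable_simple_limit mD sf.
exists g, N; split=> //.
have fgP t_ := bochner_approx_ae_eq mD t_ mN N0 gf.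
have gs := (fgP _).1 fs.
split.
  have /(integrable_mkcond _ mD) := bochner_approx_integrable_rnorm mD gl gs.
  congr (is_true (integrable _ _ _)); apply/funext => x; rewrite patchE.
  by case: ifPn => //; rewrite notin_setE => /g0 ->; rewrite rnorm0.
have ex : exists I : H, exists2 t_ : nat -> T -> H, bochner_approx mu D f t_ &
    simple_integral mu D (t_ n) @[n --> \oo] --> I.
  by have /cvg_ex[I sI] := simple_integral_cvg gl gs; exists I, s_.
have [t_ /fgP gt tI] := xgetPex (0 : H) ex; move=> v.
rewrite (simple_integral_rinner_lim gl gt v tI) Rintegral_mkcond.
apply: eq_Rintegral => x _; rewrite patchE; case: ifPn => //.
by rewrite notin_setE => /g0 ->; rewrite rinner0l.
Qed.

End bochner_integral_hilbert.

(** * Product measures *)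

Section null_sets_product.
Context d1 d2 (T1 : measurableType d1) (T2 : measurableType d2) (R : realType).
Variables (m1 : {sigma_finite_measure set T1 -> \bar R})
  (m2 : {sigma_finite_measure set T2 -> \bar R}).

Lemma ae_fst_notin N : measurable N -> m1 N = 0%E ->
  {ae (m1 \x m2)%E, forall p : T1 * T2, ~ N p.1}.
Proof.
move=> mN N0; exists (N `*` setT); split; first exact: measurableX.
- transitivity (m1 N * m2 setT)%E; first exact: product_measure1E.
  by rewrite N0 mul0e.
- by move=> p /= /contrapT.
Qed.

Lemma ae_snd_notin N : measurable N -> m2 N = 0%E ->
  {ae (m1 \x m2)%E, forall p : T1 * T2, ~ N p.2}.
Proof.
move=> mN N0; exists (setT `*` N); split; first exact: measurableX.
- transitivity (m1 setT * m2 N)%E; first exact: product_measure1E.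
  by rewrite N0 mule0.
- by move=> p /= /contrapT.
Qed.

End null_sets_product.

(** * Equality of integrals of ordered functions *)

Section ae_le_eq.
Context d (T : measurableType d) (R : realType) (mu : {measure set T -> \bar R}).
Variables (D : set T) (f g : T -> R).
Hypotheses (mD : measurable D) (mf : measurable_fun D f) (mg : measurable_fun D g).
Hypotheses (f0 : forall x, D x -> 0 <= f x) (g0 : forall x, D x -> 0 <= g x).
Hypotheses (fg : {ae mu, forall x, D x -> f x <= g x}).
Local Open Scope ereal_scope.

(** When the integrals agree, both are finite, so they can be subtracted: [g - f] is nonnegative
    a.e. with integral 0, hence null a.e. *)
Lemma ae_le_integral_eqP : \int[mu]_(x in D) (f x)%:E < +oo ->
  \int[mu]_(x in D) (f x)%:E = \int[mu]_(x in D) (g x)%:E <->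
  {ae mu, forall x, D x -> f x = g x}.
Proof.
move=> foo; split=> [fgE|fgE]; last first.
  apply: ge0_ae_eq_integral => //; try exact/measurable_EFinP.
  by apply: filterS fgE => x h /h ->.
have ge0_integrable (h : T -> R) : measurable_fun D h ->
    (forall x, D x -> (0 <= h x)%R) ->
    \int[mu]_(x in D) (h x)%:E < +oo -> mu.-integrable D (EFin \o h).
  move=> mh h0 hoo; apply/integrableP; split; first exact/measurable_EFinP.
  rewrite (eq_integral (EFin \o h))// => x; rewrite inE => Dx.
  by rewrite gee0_abs// lee_fin h0.
have if_ := ge0_integrable _ mf f0 foo.
have ig : mu.-integrable D (EFin \o g) by apply: ge0_integrable => //; rewrite -fgE.
have igf := integrableB mD ig if_.
have : ae_eq mu D (fun x => (g x - f x)%:E) (cst 0).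
  apply/(ae_eq_integral_abs _ mD); first exact: measurable_int igf.
  transitivity (\int[mu]_(x in D) ((g x)%:E - (f x)%:E)).
    apply: ae_eq_integral => //.
    - by apply: measurableT_comp => //; exact: measurable_int igf.
    - exact: measurable_int igf.
    - apply: filterS fg => x h Dx; rewrite gee0_abs// lee_fin subr_ge0; exact: h.
  rewrite integralB_EFin// -fgE subee//.
  by rewrite ge0_fin_numE// integral_ge0// => x Dx; rewrite lee_fin f0.
apply: filterS => x h /h /eqP; rewrite eqe subr_eq0 => /eqP //.
Qed.

End ae_le_eq.

(** * Symmetric integrands on the plane *)

Section symmetric_integral.
Context (R : realType).
Notation mu := (@lebesgue_measure R).
Local Open Scope ereal_scope.

Lemma measurable_lower_triangle : measurable [set p : R * R | (p.1 <= p.2)%R].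
Proof.
have mle : measurable_fun setT (fun p : R * R => (p.1 <= p.2)%R).
  by apply: measurable_fun_ler; [exact: measurable_fst|exact: measurable_snd].
by rewrite -[X in measurable X]setTI; exact: mle.
Qed.

(** The two sides of the diagonal contribute equally: Tonelli is applied to them in opposite orders,
    and by symmetry the inner integrals have the same integrand, over []y, +oo[] and [[y, +oo[],
    which differ by one point. *)
Lemma ge0_integral_symmetric (f : R * R -> \bar R) : measurable_fun setT f ->
  (forall p, 0 <= f p) -> (forall x y, f (x, y) = f (y, x)) ->
  \int[mu \x mu]_p f p =
  2%:E * \int[mu \x mu]_(p in [set p | (p.1 <= p.2)%R]) f p.
Proof.
move=> mf f0 fC.
have mA := measurable_lower_triangle.
set A := [set _ | _] in mA *.
rewrite -(setUv A) ge0_integral_setU//; last 3 first.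
- exact: measurableC.
- by rewrite setUv.
- exact/disj_setPCl.
suff -> : \int[mu \x mu]_(p in ~` A) f p = \int[mu \x mu]_(p in A) f p.
  by rewrite mule_natl mule2n.
rewrite integral_mkcond [RHS]integral_mkcond.
have fE0 (E : set (R * R)) p : 0 <= (f \_ E) p by apply: erestrict_ge0.
rewrite fubini_tonelli2//; last first.
  by apply/(measurable_restrictT _ (measurableC mA)); exact: measurable_funTS.
rewrite [RHS]fubini_tonelli1//; last first.
  by apply/(measurable_restrictT _ mA); exact: measurable_funTS.
apply: eq_integral => y _.
have mfy : measurable_fun setT (fun x => f (y, x)) by exact: measurableT_comp.
transitivity (\int[mu]_(x in `]y, +oo[) f (y, x)).
  rewrite [RHS]integral_mkcond; apply: eq_integral => x _.
  rewrite !patchE fC; congr (if _ then _ else _).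
  by apply/idP/idP; rewrite !inE /= in_itv /= andbT ltNge => /negP.
transitivity (\int[mu]_(x in `[y, +oo[) f (y, x)).
  by apply: integral_itv_obnd_cbnd; exact: measurable_funTS.
rewrite [LHS]integral_mkcond; apply: eq_integral => x _.
rewrite !patchE; congr (if _ then _ else _).
by apply/idP/idP; rewrite !inE /= in_itv /= andbT.
Qed.
End symmetric_integral.

(** * The Cauchy-Schwarz defect *)

Section schwarz_defect.
Context d (T : measurableType d) (R : realType) (k : scalars).
Context (H : hilbertSpace R k).
Variable mu : {sigma_finite_measure set T -> \bar R}.

Definition schwarz_defect (g : T -> H) (p : T * T) : R :=
  rnorm (g p.1) * rnorm (g p.2) - rinner (g p.1) (g p.2).

Variable g : T -> H.
Hypothesis gl : simple_limit mu g.

Lemma schwarz_defect_ge0 p : 0 <= schwarz_defect g p.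
Proof. by rewrite subr_ge0 le_rinner. Qed.

Lemma measurable_schwarz_defect : measurable_fun setT (schwarz_defect g).
Proof.
have mg := measurable_rnorm gl.
apply: measurable_funB; last exact: measurable_rinner2 gl.
apply: measurable_funM.
  exact: (measurableT_comp mg (@measurable_fst _ _ T T)).
exact: (measurableT_comp mg (@measurable_snd _ _ T T)).
Qed.

Lemma integral_schwarz_defect (I : H) :
  mu.-integrable setT (fun x => (rnorm (g x))%:E) ->
  (forall v, rinner I v = \int[mu]_x rinner (g x) v) ->
  (\int[mu \x mu]_p (schwarz_defect g p)%:E =
    ((\int[mu]_x rnorm (g x)) ^+ 2 - rnorm I ^+ 2)%:E)%E.
Proof.
move=> ig Iv; set L := \int[mu]_x rnorm (g x).
have irg v := integrable_rinner measurableT v gl ig.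
have EFinE (h : T -> R) : mu.-integrable setT (EFin \o h) ->
    (\int[mu]_x (h x)%:E)%E = (\int[mu]_x h x)%:E.
  by move=> ih; rewrite /Rintegral fineK//; exact: integrable_fin_num.
rewrite fubini_tonelli1/=; last 2 first.
- by apply/measurable_EFinP; exact: measurable_schwarz_defect.
- by move=> p; rewrite lee_fin schwarz_defect_ge0.
(* Integrating in the second variable uses [Iv] with [v] equal to [g x]; the remaining integration
   uses it with [v] equal to [I], which produces |I|^2. *)
transitivity (\int[mu]_x (rnorm (g x) * L - rinner (g x) I)%:E)%E.
  apply: eq_integral => x _; rewrite /fubini_F /schwarz_defect /=.
  have ix : mu.-integrable setT (EFin \o (fun y => rnorm (g x) * rnorm (g y))).
    exact: (integrableZl measurableT _ ig).
  have iy : mu.-integrable setT (EFin \o (fun y => rinner (g x) (g y))).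
    by under [X in integrable _ _ X]eq_fun do rewrite rinnerC; exact: irg.
  rewrite EFinE; last exact: (integrableB measurableT ix iy).
  rewrite RintegralB// RintegralZl// rinnerC Iv.
  congr (_ - _)%:E; apply: eq_Rintegral => y _; exact: rinnerC.
have iL : mu.-integrable setT (EFin \o (fun x => rnorm (g x) * L)).
  under [X in integrable _ _ X]eq_fun do rewrite /= mulrC.
  exact: (integrableZl measurableT _ ig).
rewrite EFinE; last exact: (integrableB measurableT iL (irg I)).
rewrite RintegralB//; last exact: (irg I).
by rewrite RintegralZr// -Iv rinnerxx expr2.
Qed.

End schwarz_defect.

(** * Integration over the triangle *)

Section Delta_integral.
Context (R : realType) (a b : R).
Notation mu := (@lebesgue_measure R).

Lemma DeltaE : Delta a b =
  [set p | p.1 <= p.2] `&` ([set` `[a, b]] `*` [set` `[a, b]]).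
Proof.
apply/seteqP; split=> [p [ap pp pb]|p [pp [/=]]]; last first.
  by rewrite !in_itv /= => /andP[ap _] /andP[_ pb].
split=> //=; rewrite !in_itv /= ap pb (le_trans ap pp) (le_trans pp pb)//.
Qed.

Lemma measurable_Delta : measurable (Delta a b).
Proof.
rewrite DeltaE; apply: measurableI; first exact: measurable_lower_triangle.
exact: measurableX.
Qed.

Lemma integral_Delta_snd (h : R -> R) : measurable_fun setT h ->
  (forall x, 0 <= h x) ->
  (\int[mu \x mu]_(p in Delta a b) (h p.2)%:E =
   \int[mu]_(s in `[a, b]) ((s - a) * h s)%:E)%E.
Proof.
move=> mh h0; rewrite integral_mkcond fubini_tonelli2; last 2 first.
- apply/(measurable_restrictT _ measurable_Delta); apply: measurable_funTS.
  by apply/measurable_EFinP; exact: (measurableT_comp mh (@measurable_snd _ _ R R)).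
- by move=> p; apply: erestrict_ge0 => x _; rewrite lee_fin.
rewrite [RHS]integral_mkcond; apply: eq_integral => s _; rewrite /fubini_G /=.
rewrite [RHS]patchE; case: ifPn => [|sab]; last first.
  apply: integral0_eq => t _; rewrite patchE; case: ifPn => //.
  rewrite inE DeltaE => -[_ [_ /= sab']].
  by rewrite notin_setE in sab.
rewrite inE /= in_itv /= => /andP[as_ sb].
(* The section of the triangle at height [s] is [[a, s]], whose length is the weight [s - a]. *)
transitivity (\int[mu]_(t in `[a, s]) (h s)%:E)%E.
  rewrite [RHS]integral_mkcond; apply: eq_integral => t _.
  rewrite !patchE; congr (if _ then _ else _).
  apply/idP/idP; rewrite !inE /= in_itv /=; first by case=> /= -> ->.
  by move=> /andP[at_ ts]; split.
rewrite integral_cst//= lebesgue_measure_itv /= lte_fin.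
(* The length formula for intervals branches on [a < s]; in the other branch [s = a] and both sides
   vanish. *)
case: ltP => [|sa]; first by rewrite -EFinB -EFinM mulrC.
have -> : s = a by apply/eqP; rewrite eq_le as_ sa.
by rewrite subrr mul0r mule0.
Qed.

End Delta_integral.

(** Points with a coordinate in [N] form two null strips. This transfers conditions between a.e.
    equal functions and, with [N] empty, handles pointwise implications. *)
Lemma ae_Delta_congr (R : realType) (a b : R) (P Q : R -> R -> Prop) (N : set R) :
  measurable N -> @lebesgue_measure R N = 0%E ->
  (forall t s, Delta a b (t, s) -> ~ N t -> ~ N s -> P t s -> Q t s) ->
  ae_Delta a b P -> ae_Delta a b Q.
Proof.
move=> mN N0 PQ.
have := @ae_snd_notin _ _ _ _ _ (@lebesgue_measure R) (@lebesgue_measure R) _ mN N0.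
have := @ae_fst_notin _ _ _ _ _ (@lebesgue_measure R) (@lebesgue_measure R) _ mN N0.
apply: filterS3 => -[t s] /= Nt Ns h Dts; exact: PQ (h Dts).
Qed.

(** Cancellation is valid for infinite [y] and [z] because [x] is finite and 2 is positive; the
    weighted integral in the theorem may be [+oo]. *)
Lemma adde_mul2I (R : realDomainType) (x : R) (y z : \bar R) :
  (x%:E + 2%:E * y = x%:E + 2%:E * z -> y = z)%E.
Proof.
have p2 : (0 < 2%:E :> \bar R)%E by rewrite lte_fin.
case: y z => [y||] [z||]; rewrite ?gt0_muley ?gt0_muleNy// => -[] /addrI.
by move=> /(mulfI (lt0r_neq0 (ltr0Sn _ 1))) ->.
Qed.

(** * The inequality and its equality case for pointwise limits *)

Section schwarz_defect_on_Delta.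
Context (R : realType) (k : scalars) (H : hilbertSpace R k) (a b : R).
Notation mu := (@lebesgue_measure R).
Variables (g : R -> H) (I : H) (c : R).
Hypotheses (gl : simple_limit mu g)
  (g0 : forall x, ~ `[a, b]%classic x -> g x = 0).
Hypothesis ig : mu.-integrable setT (fun x => (rnorm (g x))%:E).
Hypothesis Iv : forall v, rinner I v = \int[mu]_x rinner (g x) v.
Hypothesis c0 : 0 <= c.
Hypothesis KG : ae_Delta a b (fun t s =>
  rnorm (g t) * rnorm (g s) - rinner (g t) (g s) <= c * rnorm (g s) ^+ 2).

Let D : set R := `[a, b]%classic.
Let L := \int[mu]_x rnorm (g x).
Let h s := rnorm (g s) ^+ 2.
Let B := (\int[mu \x mu]_(p in Delta a b) (schwarz_defect g p)%:E)%E.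
Let G := (\int[mu \x mu]_(p in Delta a b) (c * h p.2)%:E)%E.

Let h0 s : 0 <= h s. Proof. exact: sqr_ge0. Qed.

Let mh : measurable_fun setT h.
Proof. by apply: measurable_funX; exact: measurable_rnorm gl. Qed.

Let mK : measurable_fun setT (schwarz_defect g).
Proof. exact: measurable_schwarz_defect gl. Qed.

Let mh2 : measurable_fun setT (fun p : R * R => h p.2).
Proof. exact: (measurableT_comp mh (@measurable_snd _ _ R R)). Qed.

Let integral_rnormE : (\int[mu]_(t in `[a, b]) (rnorm (g t))%:E = L%:E)%E.
Proof.
rewrite /L /Rintegral fineK; last exact: integrable_fin_num.
rewrite [LHS]integral_mkcond; apply: eq_integral => x _; rewrite patchE.
by case: ifPn => //; rewrite notin_setE => /g0 ->; rewrite rnorm0.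
Qed.

Let BE : (2%:E * B = (L ^+ 2 - rnorm I ^+ 2)%:E)%E.
Proof.
rewrite -(integral_schwarz_defect gl ig Iv) ge0_integral_symmetric; last 3 first.
- by apply/measurable_EFinP; exact: mK.
- by move=> p; rewrite lee_fin schwarz_defect_ge0.
- by move=> x y; rewrite /schwarz_defect /= mulrC rinnerC.
(* The half-plane reduces to [Delta a b]: the defect vanishes as soon as one coordinate leaves
   [[a, b]], where [g] is 0. *)
congr (_ * _)%E; rewrite /B integral_mkcond [RHS]integral_mkcond.
apply: eq_integral => -[x y] _; rewrite !patchE DeltaE in_setI.
case: ifPn => [/andP[->]//|]; rewrite negb_and => /orP[/negbTE->//|].
rewrite notin_setE => Dxy; case: ifPn => // _.
have [Dx|Dx] := pselect (D x); last first.
  by rewrite /schwarz_defect /= (g0 Dx) rnorm0 mul0r rinner0l subrr.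
have [Dy|Dy] := pselect (D y); first by case: Dxy.
by rewrite /schwarz_defect /= (g0 Dy) rnorm0 mulr0 rinnerC rinner0l subrr.
Qed.

(** By [BE], twice [B] is a real number. The equality case rests on this finiteness, since [G] may
    be infinite. *)
Let Boo : (B < +oo)%E.
Proof.
rewrite ltey; apply/eqP => Boo; have := BE.
by rewrite Boo gt0_muley ?lte_fin.
Qed.

Let lhsE : ((\int[mu]_(t in `[a, b]) (rnorm (g t))%:E) ^+ 2 =
  (rnorm I ^+ 2)%:E + 2%:E * B)%E.
Proof. by rewrite BE -EFinD subrKC integral_rnormE. Qed.

Let rhsE : ((2 * c)%:E * \int[mu]_(s in `[a, b]) ((s - a) * rnorm (g s) ^+ 2)%:E =
  2%:E * G)%E.
Proof.
rewrite EFinM -muleA; congr (_ * _)%E; rewrite -(integral_Delta_snd a b mh h0) /G.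
have mD := measurable_Delta a b.
have mhD : measurable_fun (Delta a b) (fun p : R * R => (h p.2)%:E).
  by apply/measurable_EFinP; exact: measurable_funTS.
transitivity (\int[mu \x mu]_(p in Delta a b) (c%:E * (h p.2)%:E))%E.
  by apply/esym; apply: ge0_integralZl => //; move=> p _; rewrite lee_fin.
by apply: eq_integral => p _; rewrite EFinM.
Qed.

Lemma sqr_integral_rnorm_le :
  ((\int[mu]_(t in `[a, b]) (rnorm (g t))%:E) ^+ 2 <= (rnorm I ^+ 2)%:E +
   (2 * c)%:E * \int[mu]_(s in `[a, b]) ((s - a) * rnorm (g s) ^+ 2)%:E)%E.
Proof.
rewrite lhsE rhsE leeD2l// lee_pmul2l//; apply: ae_ge0_le_integral.
- exact: measurable_Delta.
- by move=> p _; rewrite lee_fin schwarz_defect_ge0.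
- by apply/measurable_EFinP; exact: measurable_funTS.
- by move=> p _; rewrite lee_fin mulr_ge0.
- by apply/measurable_EFinP; apply: measurable_funTS; exact: measurable_funM.
- exact: KG.
Qed.

Lemma sqr_integral_rnorm_eqP :
  ((\int[mu]_(t in `[a, b]) (rnorm (g t))%:E) ^+ 2 = (rnorm I ^+ 2)%:E +
   (2 * c)%:E * \int[mu]_(s in `[a, b]) ((s - a) * rnorm (g s) ^+ 2)%:E)%E <->
  ae_Delta a b (fun t s =>
    rnorm (g t) * rnorm (g s) - rinner (g t) (g s) = c * rnorm (g s) ^+ 2).
Proof.
rewrite lhsE rhsE.
have := @ae_le_integral_eqP _ _ R (mu \x mu)%E (Delta a b)
  (schwarz_defect g) (fun p => c * h p.2) (measurable_Delta a b)
  (measurable_funTS mK) (measurable_funTS (measurable_funM (measurable_cst c) mh2))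
  (fun p _ => schwarz_defect_ge0 g p) (fun p _ => mulr_ge0 c0 (h0 p.2)) KG Boo.
move=> [BGae aeBG]; split=> [/adde_mul2I/BGae//|/aeBG BG].
by rewrite /B BG.
Qed.

End schwarz_defect_on_Delta.

(** * Transfer to Bochner integrable functions *)

Unset Implicit Arguments.

Theorem theorem3 (R : realType) (k : scalars) (H : hilbertSpace R k)
    (a b : R) (ab : a <= b) (f : R -> H)
    (fL : bochner_integrable (@lebesgue_measure R) `[a, b] f)
    (M m : R) (M_ge1 : 1 <= M) (m_le1 : m <= 1) (m_ge0 : 0 <= m) :
  let cond_inner := ae_Delta a b (fun t s =>
    0 <= scalar_Re (inner H (rscale M (f s) - f t) (f t - rscale m (f s)))) in
  let cond_norm := ae_Delta a b (fun t s =>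
    rnorm (f t - rscale ((M + m) / 2) (f s)) <= 1 / 2 * (M - m) * rnorm (f s)) in
  let lhs : \bar R :=
    ((\int[@lebesgue_measure R]_(t in `[a, b]) (rnorm (f t))%:E) ^+ 2)%E in
  let rhs : \bar R :=
    ((rnorm (bochner_integral (@lebesgue_measure R) `[a, b] f) ^+ 2)%:E
     + (1 / 2 * ((M - m) ^+ 2 / (M + m)))%:E
       * \int[@lebesgue_measure R]_(s in `[a, b])
           ((s - a) * rnorm (f s) ^+ 2)%:E)%E in
  (cond_inner <-> cond_norm) /\
  (cond_inner \/ cond_norm ->
    (lhs <= rhs)%E /\
    (lhs = rhs <->
     ae_Delta a b (fun t s =>
       rnorm (f t) * rnorm (f s) - scalar_Re (inner H (f t) (f s))
       = 1 / 4 * ((M - m) ^+ 2 / (M + m)) * rnorm (f s) ^+ 2))).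
Proof.
move=> cond_inner cond_norm lhs rhs.
have mM : m <= M by lra.
have Mm : 0 < M + m by lra.
have condE : cond_inner <-> cond_norm.
  by split; apply: (ae_Delta_congr measurable0 (measure0 _)) => t s _ _ _;
    rewrite (rinner_sandwich_ge0 (f t) (f s) mM).
split=> // cond; have {condE cond} cI : cond_inner.
  by case: cond => // /condE.
have [g [N [[gl mN N0 g0 gf] [ig Iv]]]] := @bochner_integral_version _ _ R k H
  (@lebesgue_measure R) _ (measurable_itv _) f fL.
set I := bochner_integral _ _ _ in rhs Iv *.
(* The pointwise constant on the triangle, half the coefficient of the weighted integral; passing
   from the triangle to the square doubles it. *)
pose c := 1 / 4 * ((M - m) ^+ 2 / (M + m)).
have c0 : 0 <= c by rewrite mulr_ge0// mulr_ge0 ?sqr_ge0// invr_ge0 ltW.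
have gfD t s : Delta a b (t, s) -> ~ N t -> ~ N s -> g t = f t /\ g s = f s.
  by rewrite DeltaE => -[_ [/= Dt Ds]] Nt Ns; split; apply: gf.
have KG : ae_Delta a b (fun t s =>
    rnorm (g t) * rnorm (g s) - rinner (g t) (g s) <= c * rnorm (g s) ^+ 2).
  apply: (ae_Delta_congr mN N0) cI => t s Dts Nt Ns.
  by have [-> ->] := gfD t s Dts Nt Ns; exact: rnormM_sub_rinner_le.
(* Both integrals in the statement have this form: weight 1 with the norm, and weight [s - a] with
   its square. As [f] may fail to be measurable, [f] is exchanged for [g] by discarding [N] from the
   domain. *)
have fgE (w : R -> R) (phi : H -> R) : (forall s, `[a, b]%classic s -> 0 <= w s) ->
    (forall x, 0 <= phi x) ->
    (\int[@lebesgue_measure R]_(s in `[a, b]) (w s * phi (f s))%:E =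
     \int[@lebesgue_measure R]_(s in `[a, b]) (w s * phi (g s))%:E)%E.
  move=> w0 phi0; have mD := measurable_itv `[a, b].
  rewrite (@ge0_integral_setD_null _ _ R (@lebesgue_measure R) _ _ _ mD mN N0) =>
    [|s Ds]; last by rewrite lee_fin mulr_ge0// w0.
  rewrite [RHS](@ge0_integral_setD_null _ _ R (@lebesgue_measure R) _ _ _ mD mN N0) =>
    [|s Ds]; last by rewrite lee_fin mulr_ge0// w0.
  by apply: eq_integral => s; rewrite inE => /gf ->.
have lhsE : lhs = ((\int[@lebesgue_measure R]_(t in `[a, b]) (rnorm (g t))%:E) ^+ 2)%E.
  have := fgE (fun=> 1) (@rnorm _ _ H) (fun _ _ => ler01) (@rnorm_ge0 _ _ H).
  rewrite /lhs; under eq_integral do rewrite mul1r.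
  by move=> ->; under eq_integral do rewrite mul1r.
have rhsE : rhs = ((rnorm I ^+ 2)%:E + (2 * c)%:E *
    \int[@lebesgue_measure R]_(s in `[a, b]) ((s - a) * rnorm (g s) ^+ 2)%:E)%E.
  rewrite /rhs (fgE (fun s => s - a) (fun x => rnorm x ^+ 2)) => [|s|x].
  - by congr (_ + _%:E * _)%E; rewrite /c; field; rewrite gt_eqF.
  - by rewrite /= in_itv /= subr_ge0 => /andP[].
  - exact: sqr_ge0.
rewrite lhsE rhsE; split; first exact: sqr_integral_rnorm_le KG.
rewrite (sqr_integral_rnorm_eqP gl g0 ig Iv c0 KG).
split; apply: (ae_Delta_congr mN N0) => t s Dts Nt Ns;
  by have [-> ->] := gfD t s Dts Nt Ns.
Qed.
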